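(* There is a function $\delta'=\delta'(\delta)$ of $\delta>0$ with $\delta'(\delta)\to0$ as $\delta\to0^+$ such that the following holds for every $\delta>0$, every finite group $G$ (written multiplicatively) of order $N$ and all subsets $A,B,C,D,E\subseteq G$. If $$\frac1N\sum_{g\in E} r_{A,B}(g)\,r_{C,D}(g)<\delta N^2,$$ then there are subsets $A'\subseteq A$, $B'\subseteq B$, $C'\subseteq C$, $D'\subseteq D$, $E'\subseteq E$, each obtained by removing at most $\delta' N$ elements from the respective set, such that $$\sum_{g\in E'} r_{A',B'}(g)\,r_{C',D'}(g)=0.$$ In particular (with the same quantification over $\delta$, $G$ and the sets): 1. If $\frac1N\sum_{g\in E} r_A^2(g)<\delta N^2$, then there are $A'\subseteq A$ and $E'\subseteq E$ with $|A\setminus A'|\le\delta' N$ and $|E\setminus E'|\le\delta' N$ such that $(A')^2\cap E'=\emptyset$. 2. If $\frac1N\sum_{g\in G\setminus A} r_A^2(g)<\delta N^2$, then there is $A'\subseteq A$ with $|A\setminus A'|\le\delta' N$ such that $\bigl||(A')^2|-|A'|\bigr|\le\delta' N$. 3. If $\frac1N\sum_{g\in G} r_{A,B}(g)\,r_{B,A}(g)<\delta N^2$, then there are $A'\subseteq A$ and $B'\subseteq B$ with $|A\setminus A'|\le\delta' N$ and $|B\setminus B'|\le\delta' N$ such that $|A'B'\cap B'A'|\le\delta' N$.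
   Context: For a finite group $G$ and $A,B\subseteq G$, the representation function $r_{A,B}:G\to\mathbb{N}$ is defined by $r_{A,B}(g)=|\{(a,b)\in A\times B: ab=g\}|$. We write $r_A$ for $r_{A,A}$, and $r_A^2(g)=(r_A(g))^2$. Product sets: $AB=\{ab: a\in A,\ b\in B\}$ and $A^2=AA$. The function $\delta'$ does not depend on $N$, on the structure of $G$, or on the sets. This is the precise meaning of the asymptotic formulation in which the hypotheses read ''$=o(N^2)$'', the sets $A',B',\ldots$ are obtained by eliminating $o(N)$ elements, and the conclusions of items 2 and 3 read $|(A')^2|=|A'|+o(N)$ and $|A'B'\cap B'A'|=o(N)$. *)

(* Defs.v *)
From mathcomp Require Import all_boot all_order all_algebra all_fingroup.
From mathcomp Require Import reals.

Set Implicit Arguments.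
Unset Strict Implicit.
Unset Printing Implicit Defensive.

(* A finite group is a finGroupType taken as a whole: its order is #|gT| and
   its subsets are the terms of type {set gT}. *)

Definition rep_fun (gT : finGroupType) (A B : {set gT}) (g : gT) : nat :=
  #|[set ab in setX A B | (ab.1 * ab.2)%g == g]|.

(* X is obtained from Y by removing at most t elements. *)
Definition removes_at_most (R : realType) (gT : finGroupType)
    (Y X : {set gT}) (t : R) : Prop :=
  X \subset Y /\ (#|Y :\: X|%:R <= t)%R.

(* Main.v *)
Require Import Defs.
From mathcomp Require Import all_boot all_order all_algebra all_fingroup.
From mathcomp Require Import reals.
From mathcomp Require Import ring lra zify.

Set Implicit Arguments.
Unset Strict Implicit.
Unset Printing Implicit Defensive.
Import Order.TTheory GRing.Theory Num.Theory.
Local Open Scope ring_scope.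

(** The quantity in the hypothesis counts the solutions of ab = cd = g with g
    in E, and the statement is a removal lemma for this pair of equations.

    It splits into two instances of a single equation ab = g.  By Markov, few
    elements g of E have r_AB(g) r_CD(g) larger than (h N)^2, and these are
    deleted from E.  Every other g has r_AB(g) <= hN or r_CD(g) <= hN.  The
    elements of the first kind carry at most h N^2 solutions of ab = g, those of
    the second kind at most h N^2 solutions of cd = g, so removing a few elements
    of A, B, C, D, E destroys both families of solutions
    ([group_triangle_removal], [removable_small]).

    The removal lemma for ab = g follows from the triangle removal lemma
    ([triangle_removal]) applied to the Cayley relations x^-1 y in A,
    y^-1 z in B, x^-1 z in E: every solution gives N edge-disjoint triangles
    (x, xa, xab).  An element is removed from its set when at least a third of
    the N edges that it labels are removed.  If all three elements of a solution
    survived, then fewer than N edges of its N triangles would be removed, and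
    one of these triangles would be left.

    Triangle removal is proved by regularity.  A partition of the vertices is
    given by a colouring.  The energy of a colouring is the squared L^2 norm of
    the conditional expectation of the relation; a pair of classes is irregular
    when some rectangle S x T inside it has the wrong number of edges.  If
    irregular pairs carry a positive proportion of all vertex pairs, cutting each
    class along all of these rectangles raises the energy by a fixed amount
    ([energy_increment]).  As the energy is bounded, boundedly many cuts lead to
    a colouring with few irregular pairs ([regularity]).  Then one deletes the
    edges between classes that are small, of low density or irregular; a triangle
    that survives lies in three classes which together contain a positive
    proportion of all triples as triangles ([triangle_counting]).

    The four conclusions are derived with explicit multiples of one error eps,
    and the function delta' is built from the qualitative statement by taking
    the infimum of the admissible eps ([exists_modulus]). *)

(** * Densities, discrepancy and irregular pairs *)

Section Density.
Variables (F : realFieldType) (V : finType).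
Implicit Types (W : V -> V -> F) (P Q S T : {set V}).

Definition wt S : F := #|S|%:R.

Definition tot W S T : F := \sum_(x in S) \sum_(y in T) W x y.

Definition dens W S T : F := tot W S T / (wt S * wt T).

Lemma wt_ge0 S : 0 <= wt S. Proof. exact: ler0n. Qed.

Lemma wt0 : wt set0 = 0. Proof. by rewrite /wt cards0. Qed.

Lemma sum2T (k : F) : \sum_(x : V) \sum_(y : V) k = k * wt [set: V] ^+ 2.
Proof. by rewrite !sumr_const -mulrnA -mulr_natr /wt cardsT natrM. Qed.

Lemma sum_wt S (k : F) : \sum_(x in S) k = k * wt S.
Proof. by rewrite sumr_const mulr_natr. Qed.

Lemma sum2_wt S T (k : F) : \sum_(x in S) \sum_(y in T) k = k * (wt S * wt T).
Proof. by under eq_bigr do rewrite sum_wt; rewrite sum_wt mulrAC mulrA. Qed.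

Lemma totE W S T : tot W S T = dens W S T * (wt S * wt T).
Proof.
rewrite /dens; have [/eqP|nz] := eqVneq (wt S * wt T) 0; last by rewrite divfK.
rewrite mulf_eq0 !pnatr_eq0 !cards_eq0 /tot => /orP[]/eqP->.
  by rewrite big_set0 wt0 !mul0r.
by rewrite wt0 !mulr0 big1 // => x _; exact: big_set0.
Qed.

Lemma dens_ge0 W S T : (forall x y, 0 <= W x y) -> 0 <= dens W S T.
Proof.
move=> W0; rewrite divr_ge0 ?mulr_ge0 ?wt_ge0 //.
by apply: sumr_ge0 => x _; apply: sumr_ge0.
Qed.

Lemma dens_le1 W S T : (forall x y, W x y <= 1) -> dens W S T <= 1.
Proof.
move=> W1; have [z|nz] := eqVneq (wt S * wt T) 0.
  by rewrite /dens z invr0 mulr0 ler01.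
rewrite ler_pdivrMr ?lt_def ?nz ?mulr_ge0 ?wt_ge0 // -sum2_wt.
by apply: ler_sum => x _; apply: ler_sum.
Qed.

Definition discrepancy W P Q S T : F := tot W S T - dens W P Q * (wt S * wt T).

(** The bound is relative to P x Q and not to S x T, so that no lower bound on
    the sizes of S and T has to be carried along. *)
Definition witness a W P Q : pred ({set V} * {set V}) := fun ST =>
  [&& ST.1 \subset P, ST.2 \subset Q &
      a * (wt P * wt Q) < `|discrepancy W P Q ST.1 ST.2|].

Definition irregular a W P Q := [exists ST, witness a W P Q ST].

(** Defaults to the empty rectangle, whose discrepancy is 0. *)
Definition cut a W P Q : {set V} * {set V} :=
  odflt (set0, set0) [pick ST | witness a W P Q ST].

Lemma cut_sub a W P Q :
  (cut a W P Q).1 \subset P /\ (cut a W P Q).2 \subset Q.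
Proof.
by rewrite /cut; case: pickP => [ST /and3P[]//|_] /=; rewrite !sub0set.
Qed.

Lemma cut_disc a W P Q : irregular a W P Q ->
  a * (wt P * wt Q) < `|discrepancy W P Q (cut a W P Q).1 (cut a W P Q).2|.
Proof.
case/existsP=> ST wST; rewrite /cut; case: pickP => [? /and3P[]//|/(_ ST)].
by rewrite wST.
Qed.

Lemma regularP a W P Q : ~~ irregular a W P Q ->
  forall S T, S \subset P -> T \subset Q ->
  `|discrepancy W P Q S T| <= a * (wt P * wt Q).
Proof.
move/existsPn => reg S T sSP sTQ; move: (reg (S, T)).
by rewrite /witness /= sSP sTQ /= -leNgt.
Qed.

End Density.
Arguments wt {F V} S.

(** * Colourings and their energy *)

Section Colouring.
Variables (F : realFieldType) (V : finType).
Implicit Types (W : V -> V -> F).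

Definition cls (K : finType) (c : V -> K) i : {set V} := [set x | c x == i].

Definition avg (K : finType) (c : V -> K) W x y : F :=
  dens W (cls c (c x)) (cls c (c y)).

Definition energy (K : finType) (c : V -> K) W : F :=
  \sum_x \sum_y avg c W x y ^+ 2.

Lemma sum_by_colour (K : finType) (c : V -> K) (g : V -> F) :
  \sum_x g x = \sum_i \sum_(x in cls c i) g x.
Proof.
rewrite (partition_big c xpredT) //=; apply: eq_bigr => i _.
by apply: eq_bigl => x; rewrite inE.
Qed.

Lemma sum2_by_colour (K : finType) (c : V -> K) (g : V -> V -> F) :
  \sum_x \sum_y g x y =
  \sum_i \sum_j \sum_(x in cls c i) \sum_(y in cls c j) g x y.
Proof.
rewrite (sum_by_colour c); apply: eq_bigr => i _.
under eq_bigr do rewrite (sum_by_colour c).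
exact: exchange_big.
Qed.

(** [avg c W] is the conditional expectation of W given the colours, hence W and
    [avg c W] have the same integral against every function of the colours. *)
Lemma avg_proj (K : finType) (c : V -> K) W (u : K -> K -> F) :
  \sum_x \sum_y avg c W x y * u (c x) (c y) =
  \sum_x \sum_y W x y * u (c x) (c y).
Proof.
rewrite !(sum2_by_colour c); apply: eq_bigr => i _; apply: eq_bigr => j _.
transitivity (tot W (cls c i) (cls c j) * u i j).
  rewrite totE mulrAC -sum2_wt; apply: eq_bigr => x; rewrite inE => /eqP xi.
  by apply: eq_bigr => y; rewrite inE => /eqP yj; rewrite /avg xi yj.
rewrite /tot mulr_suml; apply: eq_bigr => x; rewrite inE => /eqP->.
by rewrite mulr_suml; apply: eq_bigr => y; rewrite inE => /eqP->.
Qed.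

(** Pythagoras: [avg c W] is the orthogonal projection of [avg c' W] onto the
    functions of the coarser colouring. *)
Lemma energy_refine (K K' : finType) (c : V -> K) (c' : V -> K') (p : K' -> K) W :
  (forall x, c x = p (c' x)) ->
  energy c' W =
  energy c W + \sum_x \sum_y (avg c' W x y - avg c W x y) ^+ 2.
Proof.
move=> cp; have cross : \sum_x \sum_y avg c' W x y * avg c W x y = energy c W.
  pose u i j := dens W (cls c i) (cls c j).
  transitivity (\sum_x \sum_y avg c' W x y * u (p (c' x)) (p (c' y))).
    by apply: eq_bigr => x _; apply: eq_bigr => y _; rewrite /avg -!cp.
  rewrite (avg_proj c' W (fun i j => u (p i) (p j))).
  under eq_bigr do under eq_bigr do rewrite -!cp.
  rewrite -avg_proj.
  by apply: eq_bigr => x _; apply: eq_bigr => y _; rewrite expr2.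
suff -> : \sum_x \sum_y (avg c' W x y - avg c W x y) ^+ 2 =
    energy c' W - 2 * energy c W + energy c W by ring.
rewrite -{1}cross /energy mulr_sumr -sumrB -big_split /=.
apply: eq_bigr => x _; rewrite mulr_sumr -sumrB -big_split /=.
by apply: eq_bigr => y _; ring.
Qed.

Lemma energy_le (K : finType) (c : V -> K) W :
  (forall x y, 0 <= W x y <= 1) -> energy c W <= wt [set: V] ^+ 2.
Proof.
move=> W01; have -> : wt [set: V] ^+ 2 = \sum_(x : V) \sum_(y : V) 1 :> F.
  by rewrite sum2T mul1r.
apply: ler_sum => x _; apply: ler_sum => y _; rewrite expr_le1 //.
  by apply: dens_le1 => x' y'; have /andP[] := W01 x' y'.
by apply: dens_ge0 => x' y'; have /andP[] := W01 x' y'.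
Qed.

Section CutColouring.
Variables (K : finType) (c : V -> K) (a : F) (W : V -> V -> F).

Let ct i j := cut a W (cls c i) (cls c j).

(** The colour of x records on which side x lies of every rectangle that
    witnesses an irregular pair with the class of x as first or second member.
    Hence the rectangles are unions of products of new classes. *)
Definition cut_colouring x : K * {ffun K -> bool} * {ffun K -> bool} :=
  (c x, [ffun j => x \in (ct (c x) j).1], [ffun i => x \in (ct i (c x)).2]).

(** Vertex pairs are counted rather than pairs of classes, because the classes
    may have very different sizes. *)
Definition irr_mass : F :=
  \sum_i \sum_(j | irregular a W (cls c i) (cls c j))
     wt (cls c i) * wt (cls c j).

(** Let D be the difference of the new and the old conditional expectation and
    h the sum of the indicators of the witnessing rectangles, each with the sign
    of its discrepancy.  As h depends on the new colours only, D correlates with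
    h as W - [avg c W] does, that is by the sum of the absolute discrepancies,
    which is at least a e N^2.  Since |h| <= 1, summing the inequality
    D^2 >= 2 t D h - t^2 h^2 with t = a e gives |D|_2^2 >= (a e)^2 N^2, and
    Pythagoras turns this into an energy gain. *)
Lemma energy_increment e : 0 <= a -> 0 <= e ->
  e * wt [set: V] ^+ 2 <= irr_mass ->
  energy c W + (a * e) ^+ 2 * wt [set: V] ^+ 2 <= energy cut_colouring W.
Proof.
move=> a0 e0 mass.
pose d i j := discrepancy W (cls c i) (cls c j) (ct i j).1 (ct i j).2.
pose u (s t : K * {ffun K -> bool} * {ffun K -> bool}) : F :=
  Num.sg (d s.1.1 t.1.1) * (s.1.2 t.1.1)%:R * (t.2 s.1.1)%:R.
pose h x y := u (cut_colouring x) (cut_colouring y).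
have hE x y : h x y = Num.sg (d (c x) (c y)) *
    (x \in (ct (c x) (c y)).1)%:R * (y \in (ct (c x) (c y)).2)%:R.
  by rewrite /h /u /= !ffunE.
have h2 x y : h x y ^+ 2 <= 1.
  rewrite hE !exprMn sqr_sg -!natrX -!natrM lern1.
  by case: (_ != _); case: (x \in _); case: (y \in _).
pose D x y := avg cut_colouring W x y - avg c W x y.
(* [avg_proj] replaces the new average by W; then each pair of classes
   contributes the absolute discrepancy of its rectangle *)
have Dh : a * (e * wt [set: V] ^+ 2) <= \sum_x \sum_y D x y * h x y.
  apply: le_trans (_ : \sum_i \sum_j `|d i j| <= _).
    apply: le_trans (_ : a * irr_mass <= _); first exact: ler_wpM2l.
    rewrite mulr_sumr; apply: ler_sum => i _.
    rewrite mulr_sumr big_mkcond /=; apply: ler_sum => j _.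
    by case: ifP => // /cut_disc/ltW.
  have -> : \sum_x \sum_y D x y * h x y =
      \sum_x \sum_y (W x y - avg c W x y) * h x y.
    under eq_bigr do (under eq_bigr do rewrite mulrBl; rewrite sumrB).
    under [RHS]eq_bigr do (under eq_bigr do rewrite mulrBl; rewrite sumrB).
    by rewrite !sumrB avg_proj.
  rewrite (sum2_by_colour c); apply: ler_sum => i _; apply: ler_sum => j _.
  have [sS sT] : (ct i j).1 \subset cls c i /\ (ct i j).2 \subset cls c j.
    exact: cut_sub.
  rewrite normrEsg le_eqVlt; apply/orP; left; apply/eqP.
  rewrite {2}/d /discrepancy -sum2_wt /tot -sumrB mulr_sumr.
  rewrite [RHS](big_setID (ct i j).1) /= (finset.setIidPr sS).
  rewrite [X in _ = _ + X]big1 ?addr0; last first.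
    move=> x; rewrite 2!inE => /andP[/negPf xS /eqP xi].
    apply: big1 => y; rewrite inE => /eqP yj.
    by rewrite hE xi yj xS !mulr0 mul0r mulr0.
  apply: eq_bigr => x xS; move: (subsetP sS _ xS); rewrite inE => /eqP xi.
  rewrite -sumrB mulr_sumr.
  rewrite [RHS](big_setID (ct i j).2) /= (finset.setIidPr sT).
  rewrite [X in _ = _ + X]big1 ?addr0; last first.
    move=> y; rewrite 2!inE => /andP[/negPf yT /eqP yj].
    by rewrite hE xi yj yT !mulr0.
  apply: eq_bigr => y yT; move: (subsetP sT _ yT); rewrite inE => /eqP yj.
  by rewrite hE /avg xi yj xS yT !mulr1 mulrC.
rewrite (@energy_refine _ _ c cut_colouring (fun s => s.1.1)) // lerD2l.
apply: le_trans (_ : \sum_x \sum_y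
    (2 * (a * e) * (D x y * h x y) - (a * e) ^+ 2) <= _); last first.
  apply: ler_sum => x _; apply: ler_sum => y _.
  rewrite -/(D x y); have := h2 x y; have := sqr_ge0 (D x y - a * e * h x y).
  have := sqr_ge0 (a * e); nra.
have -> : \sum_x \sum_y (2 * (a * e) * (D x y * h x y) - (a * e) ^+ 2) =
    2 * (a * e) * (\sum_x \sum_y D x y * h x y)
     - (a * e) ^+ 2 * wt [set: V] ^+ 2.
  rewrite -sum2T mulr_sumr -sumrB; apply: eq_bigr => x _.
  by rewrite mulr_sumr -sumrB.
have := ler_wpM2l (mulr_ge0 a0 e0) Dh; lra.
Qed.

Lemma card_cut_colouring : #|{: K * {ffun K -> bool} * {ffun K -> bool}}| =
  (#|K| * 2 ^ #|K| * 2 ^ #|K|)%N.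
Proof. by rewrite !card_prod card_ffun card_bool. Qed.

End CutColouring.
End Colouring.

(** * The regularity lemma *)

Lemma wtT (F : realFieldType) (V : finType) : wt [set: V] = #|V|%:R :> F.
Proof. by rewrite /wt cardsT. Qed.

(** Iterated increment: each failure of regularity adds (a e)^2 N^2 to the total
    energy of the family, while k colours become at most k 4^k.  A cut made for
    one member of the family refines the colouring, so it does not lower the
    energies of the other members. *)
Lemma regularity_step (F : realFieldType) (I : finType) (a e : F) n :
  0 <= a -> 0 <= e ->
  exists M, forall (V : finType) (W : I -> V -> V -> F),
    (forall l x y, 0 <= W l x y <= 1) ->
    exists (K : finType) (c : V -> K), (#|K| <= M)%N /\
      ((forall l, irr_mass c a (W l) < e * #|V|%:R ^+ 2) \/
       (a * e) ^+ 2 * #|V|%:R ^+ 2 * n%:R <= \sum_l energy c (W l)).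
Proof.
move=> a0 e0; elim: n => [|n [M IH]].
  exists 1%N => V W W01; exists unit, (fun=> tt); rewrite card_unit; split=> //.
  right; rewrite mulr0; apply: sumr_ge0 => l _; apply: sumr_ge0 => x _.
  by apply: sumr_ge0 => y _; exact: sqr_ge0.
exists (M * 2 ^ M * 2 ^ M)%N => V W W01.
have [K [c [cM [reg|en]]]] := IH V W W01.
  exists K, c; split; last by left.
  by rewrite (leq_trans cM) // -mulnA leq_pmulr // muln_gt0 expn_gt0.
case: (pickP (fun l => e * #|V|%:R ^+ 2 <= irr_mass c a (W l))) => [l irr|reg].
  exists _, (cut_colouring c a (W l)); split.
    by rewrite card_cut_colouring !leq_mul // leq_pexp2l.
  right; rewrite -natr1 mulrDr mulr1 (bigD1 l) //=.
  move: en; rewrite (bigD1 l) //= => en.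
  have := @energy_increment _ _ _ c a (W l) e a0 e0; rewrite wtT => /(_ irr) inc.
  have le_rest : \sum_(i | i != l) energy c (W i) <=
      \sum_(i | i != l) energy (cut_colouring c a (W l)) (W i).
    apply: ler_sum => i _.
    rewrite (@energy_refine _ _ _ _ c (cut_colouring c a (W l)) (fun s => s.1.1)) //.
    rewrite lerDl; apply: sumr_ge0 => x _.
    by apply: sumr_ge0 => y _; exact: sqr_ge0.
  lra.
exists K, c; split.
  by rewrite (leq_trans cM) // -mulnA leq_pmulr // muln_gt0 expn_gt0.
by left=> l; rewrite ltNge reg.
Qed.

(** The total energy is at most #|I| N^2, so the second alternative of
    [regularity_step] fails once n exceeds #|I| / (a e)^2. *)
Lemma regularity (F : archiRealFieldType) (I : finType) (a e : F) :
  0 < a -> 0 < e ->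
  exists M, forall (V : finType) (W : I -> V -> V -> F), (0 < #|V|)%N ->
    (forall l x y, 0 <= W l x y <= 1) ->
    exists (K : finType) (c : V -> K), (#|K| <= M)%N /\
      forall l, irr_mass c a (W l) < e * #|V|%:R ^+ 2.
Proof.
move=> a0 e0; have ae : 0 < (a * e) ^+ 2 by rewrite exprn_gt0 // mulr_gt0.
have bnd : #|I|%:R / (a * e) ^+ 2 < (Num.bound (#|I|%:R / (a * e) ^+ 2))%:R.
  by rewrite archi_boundP // divr_ge0 ?ler0n // ltW.
have [M HM] := regularity_step I
  (Num.bound (#|I|%:R / (a * e) ^+ 2)) (ltW a0) (ltW e0).
exists M => V W V0 W01; have [K [c [cM [reg|en]]]] := HM V W W01.
  by exists K, c.
suff : \sum_l energy c (W l) <= #|I|%:R * #|V|%:R ^+ 2.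
  move/(le_trans en); rewrite mulrAC ler_pM2r ?exprn_gt0 ?ltr0n //.
  by rewrite -ler_pdivlMl // leNgt mulrC bnd.
apply: le_trans (_ : \sum_(l : I) #|V|%:R ^+ 2 <= _).
  by apply: ler_sum => l _; rewrite -wtT; exact: energy_le.
by rewrite sumr_const mulr_natl.
Qed.

(** * Counting and removing triangles *)

Section Triangles.
Variables (F : realFieldType) (V : finType).
Implicit Types (e : rel V) (P Q R : {set V}).

Definition ind e x y : F := (e x y)%:R.

Lemma ind01 e x y : 0 <= ind e x y <= 1.
Proof. by rewrite /ind ler0n lern1 leq_b1. Qed.

Lemma sum_sep P (p : pred V) (g : V -> F) :
  \sum_(x in [set x in P | p x]) g x = \sum_(x in P) g x * (p x)%:R.
Proof.
rewrite (eq_bigl (fun x => (x \in P) && p x)) => [|x]; last by rewrite inE.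
rewrite big_mkcondr /=; apply: eq_bigr => x _.
by case: (p x); rewrite ?mulr1 ?mulr0.
Qed.

Lemma wt_sep P (p : pred V) : wt [set x in P | p x] = \sum_(x in P) (p x)%:R :> F.
Proof.
rewrite -[LHS]mul1r -sum_wt sum_sep.
by apply: eq_bigr => x _; rewrite mul1r.
Qed.

Definition triangles e1 e2 e3 P Q R : F :=
  \sum_(x in P) \sum_(y in Q) \sum_(z in R) ind e1 x y * ind e2 y z * ind e3 x z.

(** Fix z: the pairs (x, y) that form a triangle with z are the e1-edges on the
    rectangle S z x T z of neighbours of z, so regularity of e1 replaces e1 by its
    density.  What remains is a count of paths y - z - x; for fixed x it is the
    number of e2-edges on the rectangle Q x U x, and regularity of e2 replaces e2
    by its density.  Summed over x, the sizes of the sets U x are the number of e3-edges on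
    P x R, which its density gives exactly. *)
Lemma triangle_counting e1 e2 e3 P Q R a : 0 <= a ->
  ~~ irregular a (ind e1) P Q -> ~~ irregular a (ind e2) Q R ->
  (dens (ind e1) P Q * dens (ind e2) Q R * dens (ind e3) P R - 2 * a)
    * (wt P * wt Q * wt R) <= triangles e1 e2 e3 P Q R.
Proof.
move=> a0 /regularP reg1 /regularP reg2.
set d1 := dens _ P Q; set d2 := dens _ Q R; set d3 := dens _ P R.
have d1_01 : 0 <= d1 <= 1.
  by rewrite dens_ge0 ?dens_le1 // => x y; have /andP[] := ind01 e1 x y.
pose S z := [set x in P | e3 x z]; pose T z := [set y in Q | e2 y z].
pose U x := [set z in R | e3 x z].
have triE : triangles e1 e2 e3 P Q R = \sum_(z in R) tot (ind e1) (S z) (T z).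
  rewrite /triangles.
  under eq_bigr do rewrite exchange_big /=.
  rewrite exchange_big /=; apply: eq_bigr => z _.
  rewrite /tot sum_sep; apply: eq_bigr => x _.
  rewrite sum_sep mulr_suml; apply: eq_bigr => y _.
  by rewrite /ind.
have degE : \sum_(z in R) wt (S z) * wt (T z) = \sum_(x in P) tot (ind e2) Q (U x).
  under eq_bigr do rewrite !wt_sep mulr_suml.
  rewrite exchange_big; apply: eq_bigr => x _ /=.
  rewrite /tot exchange_big /= sum_sep; apply: eq_bigr => z _.
  by rewrite mulrC.
have sumU : \sum_(x in P) wt (U x) = d3 * (wt P * wt R).
  by rewrite -totE; apply: eq_bigr => x _; rewrite wt_sep.
have step1 : d1 * (\sum_(z in R) wt (S z) * wt (T z)) - a * (wt P * wt Q) * wt R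
    <= triangles e1 e2 e3 P Q R.
  rewrite triE mulr_sumr -(sum_wt R) -sumrB; apply: ler_sum => z _.
  have sS : S z \subset P by apply/subsetP => x; rewrite inE => /andP[].
  have sT : T z \subset Q by apply/subsetP => x; rewrite inE => /andP[].
  have := reg1 _ _ sS sT; rewrite ler_norml /discrepancy -/d1 => /andP[]; lra.
have step2 : d2 * wt Q * (d3 * (wt P * wt R)) - a * (wt Q * wt R) * wt P <=
    \sum_(z in R) wt (S z) * wt (T z).
  rewrite degE -sumU mulr_sumr -(sum_wt P) -sumrB; apply: ler_sum => x _.
  have sU : U x \subset R by apply/subsetP => z; rewrite inE => /andP[].
  have := reg2 _ _ (subxx Q) sU; rewrite ler_norml /discrepancy -/d2 => /andP[]; lra.
have [d10 d11] := andP d1_01.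
have d1a : d1 * a * (wt P * wt Q * wt R) <= a * (wt P * wt Q * wt R).
  by rewrite ler_wpM2r ?mulr_ge0 ?wt_ge0 // ler_piMl.
have := ler_wpM2l d10 step2.
lra.
Qed.

Lemma triangles_sub e1 e2 e3 P Q R :
  triangles e1 e2 e3 P Q R <= triangles e1 e2 e3 [set: V] [set: V] [set: V].
Proof.
have sub (S : {set V}) (g : V -> F) : (forall x, 0 <= g x) ->
    \sum_(x in S) g x <= \sum_(x in [set: V]) g x.
  move=> g0; rewrite [leRHS](big_setID S) /= finset.setTI lerDl.
  by apply: sumr_ge0.
have p x y z : 0 <= ind e1 x y * ind e2 y z * ind e3 x z.
  by rewrite !mulr_ge0 ?ler0n.
apply: le_trans (sub _ _ _); last first.
  by move=> x; do 2 (apply: sumr_ge0 => ? _).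
apply: ler_sum => x _; apply: le_trans (sub _ _ _); last first.
  by move=> y; apply: sumr_ge0.
by apply: ler_sum => y _; exact: sub.
Qed.

End Triangles.

(** Each of the #|K| classes contributes its size or nothing. *)
Lemma sum_small (F : realFieldType) (V K : finType) (c : V -> K) (t : F) :
  0 <= t -> \sum_(x | wt (cls c (c x)) < t) 1 <= #|K|%:R * t.
Proof.
move=> t0; rewrite big_mkcond (sum_by_colour c) mulr_natl -sumr_const.
apply: ler_sum => i _.
apply: le_trans (_ : \sum_(x in cls c i) (if wt (cls c i) < t then 1 else 0) <= _).
  by apply: ler_sum => x; rewrite inE => /eqP->.
by rewrite sum_wt; case: ifP => [/ltW|_]; rewrite ?mul1r ?mul0r.
Qed.

Lemma ler_prod3 (F : realDomainType) (b x y z : F) :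
  0 <= b -> b <= x -> b <= y -> b <= z -> b ^+ 3 <= x * y * z.
Proof. by move=> b0 bx by_ bz; rewrite exprSr expr2 !ler_pM ?mulr_ge0. Qed.

(** With b = eps / 4, each of the four reasons for deleting an edge accounts for
    at most b N^2 edges.  The regularity parameter is a = b^3 / 4, so that three
    densities at least b leave b^3 - 2 a = b^3 / 2 in [triangle_counting]. *)
Lemma triangle_removal (F : archiRealFieldType) (eps : F) : 0 < eps ->
  exists2 eta : F, 0 < eta & forall (V : finType) (e : 'I_3 -> rel V),
    triangles F (e 0) (e 1) (e 2) [set: V] [set: V] [set: V]
      < eta * #|V|%:R ^+ 3 ->
    exists r : 'I_3 -> rel V,
      (forall l, \sum_x \sum_y ind F (r l) x y <= eps * #|V|%:R ^+ 2) /\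
      forall x y z, e 0 x y -> e 1 y z -> e 2 x z ->
        [|| r 0 x y, r 1 y z | r 2 x z].
Proof.
move=> eps0; pose b := eps / 4; pose a := b ^+ 3 / 4.
have b0 : 0 < b by rewrite divr_gt0.
have a0 : 0 < a by rewrite divr_gt0 ?exprn_gt0.
have [M HM] := regularity 'I_3 a0 b0.
have M0 : 0 < M.+1%:R :> F by rewrite ltr0n.
exists (b ^+ 3 / 2 * (b / M.+1%:R) ^+ 3).
  by rewrite mulr_gt0 ?exprn_gt0 ?divr_gt0 ?exprn_gt0.
move=> V e few; pose N : F := #|V|%:R.
have V0 : (0 < #|V|)%N.
  rewrite lt0n; apply: contraTneq few => ->; rewrite expr0n mulr0 -leNgt.
  by do 3 (apply: sumr_ge0 => ? _); rewrite !mulr_ge0 ?ler0n.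
have N0 : 0 < N by rewrite ltr0n.
have [K [c [cM reg]]] := HM V (fun l => ind F (e l)) V0 (fun l => ind01 _ (e l)).
(* at most M small classes cover at most b N vertices; M.+1 makes the quotient
   meaningful for M = 0 *)
pose small x := wt (cls c (c x)) < b * N / M.+1%:R.
pose irr l x y := irregular a (ind F (e l)) (cls c (c x)) (cls c (c y)).
pose sparse l x y := avg c (ind F (e l)) x y < b.
pose r l x y := e l x y && [|| irr l x y, sparse l x y, small x | small y].
have t0 : 0 <= b * N / M.+1%:R by rewrite !mulr_ge0 ?invr_ge0 // ltW.
exists r; split=> [l|x y z exy eyz exz].
  have small_le : \sum_x (small x)%:R <= b * N.
    have := sum_small c t0; rewrite -/small big_mkcond /=.
    have -> : \sum_x (if small x then 1 else 0) = \sum_x (small x)%:R :> F.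
      by apply: eq_bigr => x _; case: (small x).
    move/le_trans; apply.
    rewrite [leLHS]mulrC mulrAC ler_pdivrMr // (ler_pM2l (mulr_gt0 b0 N0)).
    by rewrite ler_nat (leq_trans cM).
  have small1 : \sum_x \sum_(y : V) (small x)%:R <= b * N ^+ 2.
    rewrite (_ : \sum_x _ = (\sum_x (small x)%:R) * N); last first.
      by rewrite mulr_suml; apply: eq_bigr => x _; rewrite sumr_const mulr_natr.
    by rewrite expr2 mulrA ler_pM2r.
  have small2 : \sum_(x : V) \sum_y (small y)%:R <= b * N ^+ 2.
    by rewrite exchange_big.
  have irr_le : \sum_x \sum_y (irr l x y)%:R <= b * N ^+ 2.
    rewrite (sum2_by_colour c); apply/ltW/(le_lt_trans _ (reg l)).
    apply: ler_sum => i _; rewrite [leRHS]big_mkcond /=.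
    apply: ler_sum => j _.
    pose k : F := (irregular a (ind F (e l)) (cls c i) (cls c j))%:R.
    have -> : \sum_(x in cls c i) \sum_(y in cls c j) (irr l x y)%:R =
        k * (wt (cls c i) * wt (cls c j)).
      rewrite -sum2_wt; apply: eq_bigr => x; rewrite inE => /eqP xi.
      by apply: eq_bigr => y; rewrite inE => /eqP yj; rewrite /irr xi yj.
    by rewrite /k; case: ifP => _; rewrite ?mul1r ?mul0r.
  have sparse_le : \sum_x \sum_y ind F (e l) x y * (sparse l x y)%:R <= b * N ^+ 2.
    pose u i j : F := (dens (ind F (e l)) (cls c i) (cls c j) < b)%R%:R.
    rewrite (_ : \sum_x _ = \sum_x \sum_y ind F (e l) x y * u (c x) (c y)) //.
    rewrite -avg_proj /N -wtT -sum2T; apply: ler_sum => x _; apply: ler_sum => y _.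
    rewrite /u -/(avg c (ind F (e l)) x y).
    by case: ltP => [/ltW|_]; rewrite ?mulr1 ?mulr0 // ltW.
  have -> : eps * #|V|%:R ^+ 2 = b * N ^+ 2 + b * N ^+ 2 + b * N ^+ 2 + b * N ^+ 2.
    by rewrite /b /N; field.
  apply: le_trans (lerD (lerD (lerD irr_le sparse_le) small1) small2).
  rewrite -!big_split /=; apply: ler_sum => x _.
  rewrite -!big_split /=; apply: ler_sum => y _.
  rewrite /ind /r -natrM -!natrD ler_nat.
  case: (e l x y) => //.
  by case: (irr _ _ _); case: (sparse _ _ _); case: (small x); case: (small y).
apply/negPn/negP; rewrite !negb_or /r exy eyz exz /=.
rewrite !negb_or /sparse /small -!leNgt => /and3P[].
case/and4P=> i1 s1 sx sy /and4P[i2 s2 _ sz] /and4P[_ s3 _ _].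
have := le_lt_trans
  (triangles_sub _ _ _ _ (cls c (c x)) (cls c (c y)) (cls c (c z))) few.
apply/negP; rewrite -leNgt.
apply: le_trans _ (triangle_counting (e 2) (ltW a0) i1 i2).
have -> : b ^+ 3 / 2 * (b / M.+1%:R) ^+ 3 * #|V|%:R ^+ 3 =
   b ^+ 3 / 2 * (b * N / M.+1%:R) ^+ 3.
  by rewrite /N; field; rewrite nat1r pnatr_eq0.
have b3 := ler_prod3 (ltW b0) s1 s2 s3.
apply: ler_pM.
- by rewrite divr_ge0 // exprn_ge0 // ltW.
- by rewrite exprn_ge0.
- by move: b3; rewrite /avg /a; lra.
- exact: ler_prod3.
Qed.

(** * Removal in groups *)

Section RepFun.
Variable gT : finGroupType.
Implicit Types A B E : {set gT}.

Lemma rep_funE A B g :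
  rep_fun A B g = (\sum_a \sum_b (a \in A) * (b \in B) * ((a * b)%g == g))%N.
Proof.
rewrite /rep_fun -sum1_card big_mkcond pair_bigA /=; apply: eq_bigr => -[a b] _.
by rewrite !inE /=; case: (a \in A); case: (b \in B); case: (_ == g).
Qed.

Lemma sum_rep_fun A B E :
  (\sum_(g in E) rep_fun A B g =
   \sum_a \sum_b (a \in A) * (b \in B) * ((a * b)%g \in E))%N.
Proof.
under eq_bigr do rewrite rep_funE.
rewrite exchange_big; apply: eq_bigr => a _ /=.
rewrite exchange_big; apply: eq_bigr => b _ /=.
rewrite -big_distrr /=; congr muln; case: (boolP (_ \in E)) => abE.
  rewrite (bigD1 (a * b)%g) //= eqxx big1 // => g /andP[_].
  by rewrite eq_sym => /negPf->.
by rewrite big1 // => g gE; case: eqP abE => // ->; rewrite gE.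
Qed.

Lemma rep_fun_gt0 A B g :
  reflect (exists a b, [/\ a \in A, b \in B & (a * b)%g = g]) (0 < rep_fun A B g)%N.
Proof.
apply: (iffP card_gt0P) => [[[a b]]|[a [b [aA bB abg]]]].
  by rewrite !inE /= => /andP[/andP[aA bB] /eqP abg]; exists a, b.
by exists (a, b); rewrite !inE /= aA bB abg eqxx.
Qed.

Lemma rep_fun_eq0 A B E : (\sum_(g in E) rep_fun A B g = 0)%N ->
  forall g, g \in E -> rep_fun A B g = 0%N.
Proof. by move/eqP; rewrite sum_nat_eq0 => /forall_inP h g /h/eqP. Qed.

End RepFun.

(** Sets and relations are indexed by 'I_3 in the order A, B, E.  An element a
    is removed when at least N/3 of the edges (x, xa) are removed, so deleting
    (eps / 4) N^2 edges costs at most 3 (eps / 4) N elements. *)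
Lemma group_triangle_removal (F : archiRealFieldType) (eps : F) : 0 < eps ->
  exists2 eta : F, 0 < eta & forall (gT : finGroupType) (A B E : {set gT}),
    (\sum_(g in E) rep_fun A B g)%N%:R < eta * #|gT|%:R ^+ 2 ->
    exists A' B' E' : {set gT},
      [/\ A' \subset A, B' \subset B & E' \subset E] /\
      [/\ #|A :\: A'|%:R <= eps * #|gT|%:R, #|B :\: B'|%:R <= eps * #|gT|%:R &
          #|E :\: E'|%:R <= eps * #|gT|%:R] /\
      (\sum_(g in E') rep_fun A' B' g = 0)%N.
Proof.
move=> eps0; have [|eta eta0 Heta] := @triangle_removal F (eps / 4).
  by rewrite divr_gt0.
exists eta => // gT A B E few.
pose N : F := #|gT|%:R.
have N0 : 0 < N by rewrite ltr0n; apply/card_gt0P; exists 1%g.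
pose X (l : 'I_3) := nth set0 [:: A; B; E] l.
pose e l : rel gT := fun x y => (x^-1 * y)%g \in X l.
have [|r [r_le r_hit]] := Heta gT e.
  rewrite (_ : triangles F _ _ _ _ _ _ = N * (\sum_(g in E) rep_fun A B g)%N%:R).
    by rewrite exprS mulrCA ltr_pM2l.
  (* substitute y = x a and z = x a b *)
  rewrite sum_rep_fun mulr_natl natr_sum -sumr_const.
  apply: eq_big => [x|x _]; first by rewrite inE.
  rewrite (reindex_inj (mulgI x)) /=.
  apply: eq_big => [a|a _]; first by rewrite inE.
  rewrite natr_sum (reindex_inj (mulgI (x * a)%g)) /=.
  apply: eq_big => [b|b _]; first by rewrite inE.
  by rewrite /ind /e !mulKg -mulgA mulKg -!natrM.
pose hits l a : nat := (\sum_x r l x (x * a)%g)%N.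
pose X' l := [set a in X l | (3 * hits l a < #|gT|)%N].
have subX l : X' l \subset X l by apply/subsetP => a; rewrite inE => /andP[].
have removed l : #|X l :\: X' l|%:R <= eps * N.
  have total : \sum_x \sum_y ind F (r l) x y = (\sum_a hits l a)%N%:R.
    rewrite natr_sum; under [RHS]eq_bigr do rewrite natr_sum.
    rewrite [RHS]exchange_big /=; apply: eq_bigr => x _.
    by rewrite (reindex_inj (mulgI x)).
  have often : (#|X l :\: X' l| * #|gT| <= 3 * \sum_a hits l a)%N.
    rewrite -sum_nat_const big_distrr /= big_mkcond /=; apply: leq_sum => a _.
    rewrite inE [_ \in X' l]inE; case: (a \in X l); rewrite ?andbF //= andbT.
    by rewrite -leqNgt; case: ifP.
  rewrite -(ler_pM2r N0); move: often; rewrite -(ler_nat F) !natrM -total.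
  move/le_trans; apply; have := r_le l; rewrite -/N expr2.
  have : 0 <= eps * (N * N) by rewrite !mulr_ge0 ?ltW.
  lra.
exists (X' 0), (X' 1), (X' 2); split; first by split; apply: subX.
split; first by split; apply: removed.
apply/eqP; rewrite sum_nat_eq0; apply/forall_inP => g.
rewrite inE => /andP[gE g_few]; rewrite eqn0Ngt; apply/rep_fun_gt0 => -[a [b []]].
rewrite !inE => /andP[aA a_few] /andP[bB b_few] abg.
(* each of the N triangles of the solution loses an edge *)
have : (#|gT| <= hits 0%R a + hits 1%R b + hits 2%R g)%N.
  rewrite {2}/hits (reindex_inj (mulIg a)) /= -!big_split /= -sum1_card.
  apply: leq_sum => x _.
  have := r_hit x (x * a)%g (x * a * b)%g.
  rewrite /e !mulKg -mulgA mulKg abg => /(_ aA bB gE).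
  by do 3 case: (r _ _ _).
lia.
Qed.

(** One eps bounds all five deletions, so that the property is monotone in delta and in
    eps and delta' can be chosen as one function for all sets. *)
Definition removable (R : realType) (delta eps : R) : Prop :=
  forall (gT : finGroupType) (A B C D E : {set gT}),
    (#|gT|%:R)^-1 * (\sum_(g in E) rep_fun A B g * rep_fun C D g)%N%:R
      < delta * #|gT|%:R ^+ 2 ->
    exists A' B' C' D' E' : {set gT},
      [/\ removes_at_most A A' (eps * #|gT|%:R),
          removes_at_most B B' (eps * #|gT|%:R),
          removes_at_most C C' (eps * #|gT|%:R),
          removes_at_most D D' (eps * #|gT|%:R) &
          removes_at_most E E' (eps * #|gT|%:R)] /\
      (\sum_(g in E') rep_fun A' B' g * rep_fun C' D' g = 0)%N.

Lemma light_sum (F : realFieldType) (gT : finGroupType) (A B E : {set gT}) (h : F) :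
  0 < h -> (forall g, g \in E -> (rep_fun A B g)%:R <= h * #|gT|%:R) ->
  (\sum_(g in E) rep_fun A B g)%N%:R < 2 * h * #|gT|%:R ^+ 2.
Proof.
move=> h0 light.
have N0 : 0 < #|gT|%:R :> F by rewrite ltr0n; apply/card_gt0P; exists 1%g.
apply: le_lt_trans (_ : h * #|gT|%:R ^+ 2 < _).
  rewrite natr_sum.
  apply: le_trans (_ : \sum_(g in E) h * #|gT|%:R <= _); first exact: ler_sum.
  rewrite sumr_const -[leLHS]mulr_natr -mulrA ler_pM2l // expr2 ler_pM2l //.
  by rewrite ler_nat max_card.
by rewrite -mulrA ltr_pMl ?ltr1n // mulr_gt0 // exprn_gt0.
Qed.

(** The three parts deleted from E are the heavy elements and the two sets
    removed by [group_triangle_removal], each of size at most (eps / 3) N. *)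
Lemma removable_small (R : realType) (eps : R) : 0 < eps ->
  exists2 delta : R, 0 < delta & removable delta eps.
Proof.
move=> eps0; have [|eta eta0 Heta] := @group_triangle_removal R (eps / 3).
  by rewrite divr_gt0.
pose h := eta / 2; have h0 : 0 < h by rewrite divr_gt0.
have etaE : eta = 2 * h by rewrite /h; field.
clearbody h.
(* Markov: #|E0| (h N)^2 < delta N^3, so #|E0| < (eps / 3) N *)
exists (h ^+ 2 * (eps / 3)); first by rewrite mulr_gt0 ?exprn_gt0 ?divr_gt0.
move=> gT A B C D E few; pose N : R := #|gT|%:R.
have N0 : 0 < N by rewrite ltr0n; apply/card_gt0P; exists 1%g.
pose p g : R := (rep_fun A B g)%:R; pose q g : R := (rep_fun C D g)%:R.
pose E0 := [set g in E | h ^+ 2 * N ^+ 2 < p g * q g].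
pose E1 := [set g in E | p g <= h * N].
pose E2 := [set g in E | q g <= h * N].
have [|A' [B' [E1' [[sA sB sE1] [[rA rB rE1] z1]]]]] := Heta gT A B E1.
  by rewrite etaE; apply: light_sum => // g; rewrite inE => /andP[].
have [|C' [D' [E2' [[sC sD sE2] [[rC rD rE2] z2]]]]] := Heta gT C D E2.
  by rewrite etaE; apply: light_sum => // g; rewrite inE => /andP[].
have rE0 : #|E0|%:R <= eps / 3 * N.
  have heavy : #|E0|%:R * (h ^+ 2 * N ^+ 2) <=
      (\sum_(g in E) rep_fun A B g * rep_fun C D g)%N%:R.
    rewrite mulr_natl -sumr_const natr_sum big_mkcond [leRHS]big_mkcond /=.
    apply: ler_sum => g _; rewrite inE; case: (g \in E) => //=.
    by case: ltP => [/ltW|_]; rewrite natrM // mulr_ge0.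
  move: few; rewrite mulrC ltr_pdivrMr // => /(le_lt_trans heavy)/ltW.
  rewrite -/N (_ : _ * N ^+ 2 * N = eps / 3 * N * (h ^+ 2 * N ^+ 2)); last by ring.
  by rewrite ler_pM2r // mulr_gt0 ?exprn_gt0.
exists A', B', C', D', (E :\: (E0 :|: (E1 :\: E1') :|: (E2 :\: E2'))).
have weak (S S' : {set gT}) : S' \subset S -> #|S :\: S'|%:R <= eps / 3 * N ->
    removes_at_most S S' (eps * N).
  move=> sS /le_trans rS; split=> //; apply: rS.
  by rewrite ler_pM2r // ler_pdivrMr // ler_pMr // ler1n.
split; first split; try exact: weak.
  split; first exact: finset.subsetDl.
  apply: le_trans (_ : (#|E0| + #|E1 :\: E1'| + #|E2 :\: E2'|)%N%:R <= _); last first.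
    by rewrite !natrD; move: rE0 rE1 rE2; rewrite /N; lra.
  rewrite ler_nat finset.setDDr finset.setDv finset.set0U.
  apply: leq_trans (subset_leq_card (finset.subsetIr _ _)) _.
  apply: leq_trans (leq_card_setU _ _) _.
  by rewrite leq_add2r leq_card_setU.
apply/eqP; rewrite sum_nat_eq0; apply/forall_inP => g.
rewrite in_setD !in_setU !in_setD !negb_or !negb_and !negbK.
case/andP=> /andP[/andP[light h1] h2] gE; rewrite muln_eq0.
case: (leP (p g) (h * N)) => [g1|pg].
  by move: h1; rewrite inE gE g1 orbF => /(rep_fun_eq0 z1)->.
case: (leP (q g) (h * N)) => [g2|qg].
  by move: h2; rewrite inE gE g2 orbF => /(rep_fun_eq0 z2)->; rewrite orbT.
move: light; rewrite inE gE /= -leNgt leNgt -exprMn expr2.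
by rewrite ltr_pM // ltW // mulr_gt0.
Qed.

(** * Consequences of removability *)

Section Removes.
Variables (R : realType) (gT : finGroupType).
Implicit Types (X Y : {set gT}) (s t : R).

Lemma removes_le Y X s t :
  s <= t -> removes_at_most Y X s -> removes_at_most Y X t.
Proof. by move=> st [sXY /le_trans rX]; split=> //; exact: rX. Qed.

Lemma removes_ge0 Y X t : removes_at_most Y X t -> 0 <= t.
Proof. by case=> _; apply: le_trans. Qed.

Lemma removesI Y X1 X2 s t : removes_at_most Y X1 s -> removes_at_most Y X2 t ->
  removes_at_most Y (X1 :&: X2) (s + t).
Proof.
move=> [s1 r1] [s2 r2]; split; first exact: subset_trans (subsetIl _ _) s1.
apply: le_trans (lerD r1 r2); rewrite -natrD ler_nat setDIr.
exact: leq_card_setU.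
Qed.

End Removes.

Lemma removable_total (R : realType) (delta : R) : removable delta 1.
Proof.
move=> gT A B C D E _; exists set0, set0, set0, set0, set0.
have r (S : {set gT}) : removes_at_most S set0 (1 * #|gT|%:R : R).
  by split; rewrite ?sub0set // setD0 mul1r ler_nat max_card.
by rewrite big_set0; split; first by split; exact: r.
Qed.

Lemma removable_mono (R : realType) (delta delta' eps eps' : R) :
  delta' <= delta -> eps <= eps' -> removable delta eps -> removable delta' eps'.
Proof.
move=> ld le rem gT A B C D E few.
have [|A' [B' [C' [D' [E' [[rA rB rC rD rE] z]]]]]] := rem gT A B C D E.
  by apply: lt_le_trans few _; rewrite ler_wpM2r ?exprn_ge0.
exists A', B', C', D', E'; split=> //.
by split; apply: removes_le (ler_wpM2r (ler0n _ _) le) _.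
Qed.

Lemma no_common_product (gT : finGroupType) (A B C D E : {set gT}) :
  (\sum_(g in E) rep_fun A B g * rep_fun C D g = 0)%N ->
  forall g a b c d, a \in A -> b \in B -> c \in C -> d \in D ->
    (a * b)%g = g -> (c * d)%g = g -> g \notin E.
Proof.
move/eqP; rewrite sum_nat_eq0 => /forall_inP z g a b c d aA bB cC dD abg cdg.
apply/negP => /z; apply/negP; rewrite -lt0n muln_gt0.
apply/andP; split; apply/rep_fun_gt0; first by exists a, b.
by exists c, d.
Qed.

(** The removal property treats the four copies of A separately; their
    intersection loses at most four times as much. *)
Lemma removable_square (R : realType) (delta eps : R) :
  removable delta eps -> forall (gT : finGroupType) (A E : {set gT}),
  (#|gT|%:R)^-1 * (\sum_(g in E) rep_fun A A g ^ 2)%N%:R < delta * #|gT|%:R ^+ 2 ->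
  exists A' E' : {set gT},
    [/\ removes_at_most A A' (4 * (eps * #|gT|%:R)),
        removes_at_most E E' (eps * #|gT|%:R) &
        (A' * A')%g :&: E' = set0].
Proof.
move=> rem gT A E few.
have [|A1 [A2 [A3 [A4 [E' [[r1 r2 r3 r4 rE] z]]]]]] := rem gT A A A A E.
  by under eq_bigr do rewrite mulnn.
exists (A1 :&: A2 :&: A3 :&: A4), E'; split=> //.
  by apply: removes_le (removesI (removesI (removesI r1 r2) r3) r4); lra.
apply/eqP; rewrite -subset0; apply/subsetP => g; rewrite inE => /andP[].
case/mulsgP=> a b; rewrite !inE -!andbA.
move=> /and4P[a1 a2 a3 a4] /and4P[b1 b2 b3 b4] gab gE.
by have := no_common_product z a1 b2 a3 b4 (esym gab) (esym gab); rewrite gE.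
Qed.

(** Applied to E = ~: A, [removable_square] puts the product set inside A up to
    few elements, which bounds it above.  The lower bound is that a nonempty set
    is at most as large as its product set, as this contains a translate. *)
Lemma removable_doubling (R : realType) (delta eps : R) :
  removable delta eps -> forall (gT : finGroupType) (A : {set gT}),
  (#|gT|%:R)^-1 * (\sum_(g in ~: A) rep_fun A A g ^ 2)%N%:R
    < delta * #|gT|%:R ^+ 2 ->
  exists A' : {set gT}, removes_at_most A A' (4 * (eps * #|gT|%:R)) /\
    `| #|(A' * A')%g|%:R - #|A'|%:R | <= 5 * (eps * #|gT|%:R).
Proof.
move=> rem gT A /(removable_square rem)[A' [E' [rA [sE rE] disj]]].
have lower : (#|A'| <= #|(A' * A')%g|)%N.
  have [->|[a aA]] := set_0Vmem A'; first by rewrite cards0.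
  by rewrite -(card_lcoset A' a) subset_leq_card // mulSg // sub1set.
have upper : (#|(A' * A')%g| <= #|A'| + #|A :\: A'| + #|~: A :\: E'|)%N.
  have sub : (A' * A')%g \subset A' :|: (A :\: A') :|: (~: A :\: E').
    apply/subsetP => g gA; have gE : g \notin E'.
      by apply/negP => gE; move/setP/(_ g): disj; rewrite !inE gA gE.
    by rewrite !inE gE; case: (g \in A'); case: (g \in A).
  apply: leq_trans (subset_leq_card sub) _.
  by rewrite (leq_trans (leq_card_setU _ _)) // leq_add2r leq_card_setU.
exists A'; split=> //; rewrite ger0_norm ?subr_ge0 ?ler_nat //.
rewrite lerBlDl; have [_ rA'] := rA.
move: upper; rewrite -(ler_nat R) !natrD => /le_trans; apply.
by move: rA' rE; lra.
Qed.

(** Here E is the whole group: a common value of A'B' and B'A' has to lie among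
    the few elements removed from E. *)
Lemma removable_commuting (R : realType) (delta eps : R) :
  removable delta eps -> forall (gT : finGroupType) (A B : {set gT}),
  (#|gT|%:R)^-1 * (\sum_(g : gT) rep_fun A B g * rep_fun B A g)%N%:R
    < delta * #|gT|%:R ^+ 2 ->
  exists A' B' : {set gT},
    [/\ removes_at_most A A' (2 * (eps * #|gT|%:R)),
        removes_at_most B B' (2 * (eps * #|gT|%:R)) &
        #|(A' * B')%g :&: (B' * A')%g|%:R <= eps * #|gT|%:R].
Proof.
move=> rem gT A B few.
have [|A1 [B1 [B2 [A2 [E' [[rA1 rB1 rB2 rA2 [_ rE]] z]]]]]] :=
    rem gT A B B A [set: gT].
  by under eq_bigl do rewrite inE.
exists (A1 :&: A2), (B1 :&: B2); rewrite mulr_natl mulr2n.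
split; [exact: removesI | exact: removesI |].
apply: le_trans rE; rewrite ler_nat subset_leq_card //.
apply/subsetP => g; rewrite !inE andbT => /andP[].
case/mulsgP=> a b; rewrite !inE => /andP[a1 _] /andP[b1 _] gab.
case/mulsgP=> b' a'; rewrite !inE => /andP[_ b2] /andP[_ a2] gba.
exact: (no_common_product z a1 b1 b2 a2 (esym gab) (esym gba)).
Qed.

(** * The error function *)

From mathcomp Require Import all_classical all_reals all_analysis.
Import numFieldNormedType.Exports.
Local Open Scope classical_set_scope.
Local Open Scope ring_scope.

(** The value at x is inf {e | P x e} + x.  The summand x makes the value exceed
    the infimum, which need not be attained, so that monotonicity yields P. *)
Lemma exists_modulus (R : realType) (P : R -> R -> Prop) :
  (forall eps, 0 < eps -> exists2 delta, 0 < delta & P delta eps) ->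
  (forall delta, exists2 eps, 0 < eps & P delta eps) ->
  (forall delta delta' eps eps', delta' <= delta -> eps <= eps' ->
     P delta eps -> P delta' eps') ->
  exists f : R -> R, f x @[x --> (0 : R)^'+] --> (0 : R) /\
    forall delta, 0 < delta -> P delta (f delta).
Proof.
move=> Psmall Ptotal Pmono; pose S x : classical_sets.set R := fun e => 0 < e /\ P x e.
have infS x : has_inf (S x).
  split; first by have [e e0 Pe] := Ptotal x; exists e.
  by exists 0 => e [/ltW].
exists (fun x => inf (S x) + x); split; last first.
  move=> x x0; have [e [e0 Pe] lt_e] := inf_adherent x0 (infS x).
  exact: Pmono (lexx _) (ltW lt_e) Pe.
apply/cvgrPdist_lt => e e0.
have [|d d0 Pd] := Psmall (e / 2); first by rewrite divr_gt0.
near=> x.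
have x0 : 0 < x by near: x; exact: nbhs_right_gt.
have xd : x < d by near: x; exact: nbhs_right_lt.
have xe : x < e / 2 by near: x; apply: nbhs_right_lt; rewrite divr_gt0.
have inf_ge0 : 0 <= inf (S x).
  by apply: lb_le_inf; [case: (infS x) | move=> u [/ltW]].
have inf_le : inf (S x) <= e / 2.
  apply: ge_inf; first by case: (infS x).
  by split; [rewrite divr_gt0 | exact: Pmono (ltW xd) (lexx _) Pd].
rewrite sub0r normrN ger0_norm ?addr_ge0 ?(ltW x0) //; lra.
Unshelve. all: by end_near.
Qed.

Theorem corollary5 (R : realType) :
  exists delta' : R -> R,
    delta' x @[x --> (0 : R)^'+] --> (0 : R) /\
    forall (delta : R), 0 < delta ->
    forall (gT : finGroupType),
    let N : R := #|gT|%:R in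
    [/\ forall A B C D E : {set gT},
          N^-1 * (\sum_(g in E) rep_fun A B g * rep_fun C D g)%N%:R
            < delta * N ^+ 2 ->
          exists A' B' C' D' E' : {set gT},
            [/\ removes_at_most A A' (delta' delta * N),
                removes_at_most B B' (delta' delta * N),
                removes_at_most C C' (delta' delta * N),
                removes_at_most D D' (delta' delta * N) &
                removes_at_most E E' (delta' delta * N)] /\
            (\sum_(g in E') rep_fun A' B' g * rep_fun C' D' g = 0)%N,
        forall A E : {set gT},
          N^-1 * (\sum_(g in E) rep_fun A A g ^ 2)%N%:R < delta * N ^+ 2 ->
          exists A' E' : {set gT},
            [/\ removes_at_most A A' (delta' delta * N),
                removes_at_most E E' (delta' delta * N) &
                (A' * A')%g :&: E' = finset.set0],
        forall A : {set gT},
          N^-1 * (\sum_(g in ~: A) rep_fun A A g ^ 2)%N%:R < delta * N ^+ 2 ->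
          exists A' : {set gT},
            removes_at_most A A' (delta' delta * N) /\
            `| #|(A' * A')%g|%:R - #|A'|%:R | <= delta' delta * N &
        forall A B : {set gT},
          N^-1 * (\sum_(g : gT) rep_fun A B g * rep_fun B A g)%N%:R
            < delta * N ^+ 2 ->
          exists A' B' : {set gT},
            [/\ removes_at_most A A' (delta' delta * N),
                removes_at_most B B' (delta' delta * N) &
                #|(A' * B')%g :&: (B' * A')%g|%:R <= delta' delta * N]].
Proof.
(* the largest loss below is 5 eps, in the doubling statement *)
have [||delta delta' eps eps' ld le|f [f0 rem]] :=
    @exists_modulus R (fun delta eps => removable delta (eps / 5)).
- by move=> eps eps0; apply: removable_small; rewrite divr_gt0.
- by move=> delta; exists 5 => //; rewrite divff //; exact: removable_total.
- by apply: removable_mono => //; rewrite ler_pM2r // invr_gt0.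
exists f; split=> // delta delta0 gT N.
have {}rem := rem _ delta0.
have fE : f delta * N = 5 * (f delta / 5 * N) by field.
rewrite fE; set t := f delta / 5 * N.
have weak s (X Y : {set gT}) : 1 <= s <= 5 -> removes_at_most Y X (s * t) ->
    removes_at_most Y X (5 * t).
  move=> /andP[s1 s5] rX; apply: removes_le (rX); apply: ler_wpM2r s5.
  by have := removes_ge0 rX; rewrite pmulr_rge0 // (lt_le_trans _ s1).
have weak1 (X Y : {set gT}) : removes_at_most Y X t -> removes_at_most Y X (5 * t).
  by rewrite -{1}[t]mul1r; apply: weak; rewrite lexx ler1n.
split=> [A B C D E few|A E few|A few|A B few].
- have [A' [B' [C' [D' [E' [[rA rB rC rD rE] z]]]]]] := rem gT A B C D E few.
  by exists A', B', C', D', E'; split=> //; split; exact: weak1.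
- have [A' [E' [rA rE disj]]] := removable_square rem few.
  exists A', E'; split=> //; [|exact: weak1].
  by apply: weak rA; rewrite ler1n ler_nat.
- have [A' [rA card]] := removable_doubling rem few.
  by exists A'; split=> //; apply: weak rA; rewrite ler1n ler_nat.
- have [A' [B' [rA rB card]]] := removable_commuting rem few.
  have t0 : 0 <= t by apply: le_trans card.
  exists A', B'; split.
  + by apply: weak rA; rewrite ler1n ler_nat.
  + by apply: weak rB; rewrite ler1n ler_nat.
  + by apply: le_trans card _; rewrite ler_peMl // ler1n.
Qed.
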